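(* Let $n\ge 1$ and let $\mathcal{A}$ be one of the following arrangements in $\mathbb{R}^n$: the type $C$ arrangement, the Boolean arrangement, the type $D$ arrangement, or the braid arrangement. Then, for every $j\ge 0$, the absolute value of the coefficient of $t^j$ in the characteristic polynomial $\chi_{\mathcal{A}}(t)$ is the number of $\mathcal{A}$-signed permutations that have exactly $j$ positive compartments.
   Context: The characteristic polynomial of an arrangement $\mathcal{A}$ in $\mathbb{R}^n$ is $\chi_{\mathcal{A}}(t)=\sum_{x}\mu(\hat 0,x)t^{\dim x}$, the sum over all flats (nonempty intersections of subsets of hyperplanes of $\mathcal{A}$, including $\hat 0=\mathbb{R}^n$), ordered by reverse inclusion, with $\mu$ the Möbius function of this poset. The arrangements are: type $C$: $2x_i=0$ ($i\in[n]$), $x_i+x_j=0$, $x_i-x_j=0$ ($1\le i<j\le n$); Boolean: $x_i=0$ ($i\in[n]$); type $D$: $x_i+x_j=0$, $x_i-x_j=0$ ($1\le i<j\le n$); braid: $x_i-x_j=0$ ($1\le i<j\le n$). A signed permutation of $[n]=\{1,\dots,n\}$ is a permutation of $[n]$ written in one-line notation in which each entry carries a sign $+$ or $-$. The $\mathcal{A}$-signed permutations of $[n]$ are: for type $C$, all signed permutations; for Boolean, those whose underlying permutation (ignoring signs) is $1\,2\cdots n$; for type $D$, those whose first entry has positive sign; for braid, those all of whose entries have positive sign. Compartments of a signed permutation: ignoring signs, draw a line before the permutation, and then repeatedly draw a line immediately following the least number occurring after the last line drawn, until a line is drawn at the end. The compartments are the strings of consecutive entries between successive lines. A compartment is positive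 if its last entry has positive sign. *)

(* Defs.v *)
From HB Require Import structures.
From mathcomp Require Import all_boot all_order all_algebra all_fingroup.
From mathcomp Require Import finmap.
From mathcomp Require Import reals.

Set Implicit Arguments.
Unset Strict Implicit.
Unset Printing Implicit Defensive.

Import Order.TTheory GRing.Theory Num.Theory.

Local Open Scope fset_scope.
Local Open Scope ring_scope.

Section Mobius.
Context {d : Order.disp_t} {T : finPOrderType d}.
Local Open Scope order_scope.

(* The first argument is fuel; [mobiusE] is the defining recursion. *)
Fixpoint mobius_fuel (k : nat) (x y : T) : int :=
  if k is k'.+1 then
    if x == y then 1%R
    else (- \sum_(z : T | (x <= z < y)%O) mobius_fuel k' x z)%R
  else 0%R.

Definition mobius (x y : T) : int := mobius_fuel #|T|.+1 x y.

Lemma mobius_fuel_stable k1 k2 (x y : T) :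
  (#|[set z : T | (z < y)%O]| < k1)%N -> (#|[set z : T | (z < y)%O]| < k2)%N ->
  mobius_fuel k1 x y = mobius_fuel k2 x y.
Proof.
elim: k1 k2 y => [|k1 IH] [|k2] y //= h1 h2.
case: eqP => // _; congr (- _)%R; apply: eq_bigr => z /andP[_ zy].
have lt_card : (#|[set t : T | (t < z)%O]| < #|[set t : T | (t < y)%O]|)%N.
  apply: proper_card; apply/properP; split.
    by apply/subsetP => t; rewrite !inE => /lt_trans; apply.
  by exists z; rewrite !inE ?zy ?ltxx.
by apply: IH; apply: leq_trans lt_card _.
Qed.

Lemma mobiusE (x y : T) :
  mobius x y =
    if x == y then 1%R
    else (- \sum_(z : T | (x <= z < y)%O) mobius x z)%R.
Proof.
rewrite {1}/mobius /=; case: eqP => // _; congr (- _)%R.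
apply: eq_bigr => z /andP[_ zy]; apply: mobius_fuel_stable.
  rewrite -cardsT; apply: proper_card; apply/properP; split.
    exact: subsetT.
  by exists z; rewrite !inE ?ltxx.
by rewrite ltnS; exact: max_card.
Qed.

End Mobius.

Section Arrangement.
Context {R : realType} {n : nat}.

(* An arrangement of linear hyperplanes in R^n.  All intersections contain the
   origin, so the nonemptiness of flats is automatic. *)
Definition arrangement := {fset {vspace 'rV[R]_n}}.

(* The empty intersection is the ambient space [fullv]. *)
Definition flats (A : arrangement) : {fset {vspace 'rV[R]_n}} :=
  [fset (\bigcap_(H <- enum_fset S) H)%VS |
    S : {fset {vspace 'rV[R]_n}} in fpowerset A].

Definition flat (A : arrangement) : Type := flats A.

HB.instance Definition _ (A : arrangement) := Finite.on (flat A).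

Definition flat_space (A : arrangement) (x : flat A) : {vspace 'rV[R]_n} :=
  fsval x.

(* Reverse inclusion. *)
Definition flat_le (A : arrangement) : rel (flat A) :=
  fun x y => (flat_space y <= flat_space x)%VS.

Lemma flat_le_refl A : reflexive (@flat_le A).
Proof. by move=> x; exact: subvv. Qed.

Lemma flat_le_anti A : antisymmetric (@flat_le A).
Proof.
move=> x y /andP[yx xy]; apply: val_inj; apply/eqP.
by rewrite eqEsubv [X in X && _]xy [X in _ && X]yx.
Qed.

Lemma flat_le_trans A : transitive (@flat_le A).
Proof. by move=> y x z yx zy; apply: subv_trans zy yx. Qed.

Fact flat_display : Order.disp_t. Proof. exact: (Order.Disp tt tt). Qed.

HB.instance Definition _ (A : arrangement) :=
  Order.isPOrder.Build flat_display (flat A)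
    (fun x y => erefl _) (@flat_le_refl A) (@flat_le_anti A)
    (@flat_le_trans A).

Lemma fullv_flats (A : arrangement) : fullv \in flats A.
Proof.
apply/imfsetP; exists fset0 => /=; first by rewrite fpowersetE fsub0set.
by rewrite big_nil.
Qed.

HB.instance Definition _ (A : arrangement) :=
  Order.hasBottom.Build flat_display (flat A)
    (fun x => subvf (flat_space x) : flat_le [` fullv_flats A] x).

Definition charpoly (A : arrangement) : {poly int} :=
  \sum_(x : flat A) mobius (\bot : flat A)%O x *: 'X^(\dim (flat_space x)).

(* The hyperplane [f x = 0], for [f] linear. *)
Definition hyperplane (f : 'rV[R]_n -> R) : {vspace 'rV[R]_n} :=
  lker (linfun (f : 'rV[R]_n -> R^o)).

Definition typeC_arr : arrangement :=
  [fset hyperplane (fun x => 2 * x 0 i) | i : 'I_n]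
  `|` [fset hyperplane (fun x => x 0 p.1 + x 0 p.2) |
        p : 'I_n * 'I_n & (p.1 < p.2)%N]
  `|` [fset hyperplane (fun x => x 0 p.1 - x 0 p.2) |
        p : 'I_n * 'I_n & (p.1 < p.2)%N].

Definition boolean_arr : arrangement :=
  [fset hyperplane (fun x => x 0 i) | i : 'I_n].

Definition typeD_arr : arrangement :=
  [fset hyperplane (fun x => x 0 p.1 + x 0 p.2) |
    p : 'I_n * 'I_n & (p.1 < p.2)%N]
  `|` [fset hyperplane (fun x => x 0 p.1 - x 0 p.2) |
        p : 'I_n * 'I_n & (p.1 < p.2)%N].

Definition braid_arr : arrangement :=
  [fset hyperplane (fun x => x 0 p.1 - x 0 p.2) |
    p : 'I_n * 'I_n & (p.1 < p.2)%N].

Lemma mem_hyperplane (f : 'rV[R]_n -> R) (x : 'rV[R]_n) :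
  linear (f : 'rV[R]_n -> R^o) -> (x \in hyperplane f) = (f x == 0).
Proof.
move=> f_lin.
pose F := GRing.isLinear.Build R 'rV[R]_n R^o *:%R f f_lin.
pose g : {linear 'rV[R]_n -> R^o} := HB.pack (f : 'rV[R]_n -> R^o) F.
by rewrite memv_ker -[f]/(g : _ -> _) lfunE.
Qed.

Lemma mem_hyperplane_double (i : 'I_n) (x : 'rV[R]_n) :
  (x \in hyperplane (fun x => 2 * x 0 i)) = (2 * x 0 i == 0).
Proof.
by apply: mem_hyperplane => a u v; rewrite !mxE mulrDr mulrCA.
Qed.

Lemma mem_hyperplane_coord (i : 'I_n) (x : 'rV[R]_n) :
  (x \in hyperplane (fun x => x 0 i)) = (x 0 i == 0).
Proof. by apply: mem_hyperplane => a u v; rewrite !mxE. Qed.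

Lemma mem_hyperplane_add (i j : 'I_n) (x : 'rV[R]_n) :
  (x \in hyperplane (fun x => x 0 i + x 0 j)) = (x 0 i + x 0 j == 0).
Proof.
by apply: mem_hyperplane => a u v; rewrite !mxE addrACA -mulrDr.
Qed.

Lemma mem_hyperplane_sub (i j : 'I_n) (x : 'rV[R]_n) :
  (x \in hyperplane (fun x => x 0 i - x 0 j)) = (x 0 i - x 0 j == 0).
Proof.
by apply: mem_hyperplane => a u v; rewrite !mxE opprD addrACA -mulrN -mulrDr.
Qed.

End Arrangement.

Arguments arrangement : clear implicits.
Arguments typeC_arr : clear implicits.
Arguments boolean_arr : clear implicits.
Arguments typeD_arr : clear implicits.
Arguments braid_arr : clear implicits.

(* [w.1 i] is the i-th entry and [w.2 i] its sign, [true] meaning +.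
   Positions and entries are numbered from 0. *)
Definition signed_perm (n : nat) : predArgType :=
  ('S_n * {ffun 'I_n -> bool})%type.

HB.instance Definition _ n := Finite.on (signed_perm n).

Definition one_line (n : nat) (w : signed_perm n) : seq ('I_n * bool) :=
  [seq (w.1 i, w.2 i) | i <- enum 'I_n].

Section Compartments.
Context {n : nat}.
Implicit Type s : seq ('I_n * bool).

(* Position of the least entry of [s], ignoring signs. *)
Definition least_pos s : nat :=
  find (fun a : 'I_n * bool => all (fun b => a.1 <= (b : 'I_n * bool).1)%N s) s.

(* The first argument is fuel; [compartmentsE] is the defining recursion. *)
Fixpoint compartments_fuel (k : nat) s : seq (seq ('I_n * bool)) :=
  match k, s with
  | k'.+1, _ :: _ =>
      take (least_pos s).+1 s
        :: compartments_fuel k' (drop (least_pos s).+1 s)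
  | _, _ => [::]
  end.

Definition compartments s := compartments_fuel (size s) s.

Lemma compartments_fuel_stable k s :
  (size s <= k)%N -> compartments_fuel k s = compartments s.
Proof.
rewrite /compartments; move: {2 4}(size s) (leqnn (size s)) => m.
elim: k m s => [|k IH] [|m] [|a s] //= hm hk; congr (_ :: _).
have sz : (size (drop (least_pos (a :: s)) s) <= size s)%N.
  by rewrite size_drop leq_subr.
by apply: IH; apply: leq_trans sz _.
Qed.

Lemma compartmentsE s :
  compartments s =
    if s is [::] then [::]
    else take (least_pos s).+1 s :: compartments (drop (least_pos s).+1 s).
Proof.
case: s => [//|a s]; rewrite {1}/compartments /=; congr (_ :: _).
by apply: compartments_fuel_stable; rewrite size_drop leq_subr.
Qed.

(* Compartments are nonempty, so the default [false] is irrelevant. *)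
Definition positive (c : seq ('I_n * bool)) : bool :=
  last false [seq a.2 | a <- c].

End Compartments.

Definition num_positive (n : nat) (w : signed_perm n) : nat :=
  count positive (compartments (one_line w)).

Inductive arr_family := TypeC | Boolean | TypeD | Braid.

Definition family_arr (R : realType) (n : nat) (F : arr_family) :
    arrangement R n :=
  match F with
  | TypeC => typeC_arr R n
  | Boolean => boolean_arr R n
  | TypeD => typeD_arr R n
  | Braid => braid_arr R n
  end.

Definition family_signed (n : nat) (F : arr_family) (w : signed_perm n) : bool :=
  match F with
  | TypeC => true
  | Boolean => [forall i, w.1 i == i]
  | TypeD => [forall i : 'I_n, (i == 0 :> nat)%N ==> w.2 i]
  | Braid => [forall i, w.2 i]
  end.

(* Main.v *)
Require Import Defs.
From HB Require Import structures.
From mathcomp Require Import all_boot all_order all_algebra all_fingroup.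
From mathcomp Require Import finmap.
From mathcomp Require Import reals.
From mathcomp Require Import ring zify.

(* Both sides are products of linear factors, up to signs.
   Arrangement side (Blass and Sagan): with q = 2m+1, every flat x of a
   subarrangement of type C contains exactly q^(dim x) points of the cube
   {-m..m}^n.  Summing mu(0,x) over the flats through a point p gives 1 if p
   lies on no hyperplane and 0 otherwise, so chi(q) is the number of points of
   the cube off the arrangement.  Choosing the coordinates one at a time counts
   these points, and infinitely many q determine chi.
   Permutation side: the compartments end at the right-to-left minima, and
   whether the first entry is one depends only on its value, so removing it
   factors the generating function of the number of positive compartments. *)

Set Implicit Arguments.
Unset Strict Implicit.
Unset Printing Implicit Defensive.

Import Order.TTheory GRing.Theory Num.Theory.

Local Open Scope fset_scope.
Local Open Scope ring_scope.

(** * Moebius inversion on flats *)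

(** When [a < y], the defining recursion makes the term at [y] cancel all the others. *)
Lemma sum_mobius {d : Order.disp_t} {T : finPOrderType d} (a y : T) :
  (a <= y)%O -> \sum_(x : T | (a <= x <= y)%O) mobius a x = (a == y)%:R.
Proof.
move=> ay; rewrite (bigD1 y) /=; last by rewrite ay lexx.
rewrite (eq_bigl (fun x => a <= x < y)%O); last first.
  by move=> x; rewrite lt_neqAle andbA andbAC.
rewrite mobiusE; case: eqP => [<-|_]; last by rewrite addNr.
by rewrite big_pred0 ?addr0 // => x; apply/andP => -[/le_lt_trans h /h]; rewrite ltxx.
Qed.

Section Charpoly.
Context {R : realType} {n : nat}.
Implicit Types (A : arrangement R n) (v : 'rV[R]_n).

Lemma mem_bigcapv (s : seq {vspace 'rV[R]_n}) v :
  (v \in (\bigcap_(H <- s) H)%VS) = all (fun H : {vspace _} => v \in H) s.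
Proof. by elim: s => [|H s IH]; rewrite ?big_nil ?memvf // big_cons memv_cap IH. Qed.

Lemma flatP A (x : flat A) :
  exists2 S : {fset {vspace 'rV[R]_n}}, (S `<=` A) &
    flat_space x = (\bigcap_(H <- enum_fset S) H)%VS.
Proof.
case: x => x xA; have /imfsetP[S /= SA ->] := xA.
by exists S => //; rewrite fpowersetE in SA.
Qed.

Lemma flat_leE A (x y : flat A) :
  (x <= y)%O = (flat_space y <= flat_space x)%VS.
Proof. by []. Qed.

(** The flats through [v] are those below the flat [m] cut out by all hyperplanes through [v], so
    the sum runs over the interval from the bottom to [m]. It is nonzero only if [m] is the whole
    space, that is, if no hyperplane contains [v], since all of them are proper. *)
Lemma sum_mobius_mem A v : (forall H, H \in A -> H != fullv) ->
  \sum_(x : flat A | v \in flat_space x) mobius (\bot : flat A)%O x =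
    (all (fun H : {vspace _} => v \notin H) (enum_fset A))%:R.
Proof.
move=> properA.
have mA : (\bigcap_(H <- enum_fset [fset H in A | v \in H]) H)%VS \in flats A.
  apply/imfsetP; exists [fset H in A | v \in H] => //=.
  by rewrite fpowersetE; apply/fsubsetP => H; rewrite !inE => /andP[].
pose m : flat A := [` mA].
have vm : v \in flat_space m.
  by rewrite mem_bigcapv; apply/allP => H; rewrite !inE => /andP[].
rewrite (eq_bigl (fun x => \bot <= x <= m)%O); last first.
  move=> x; rewrite le0x /= flat_leE; apply/idP/idP => [vx|/subvP]; last exact.
  have [S SA xS] := flatP x; apply/subvP => u; rewrite xS mem_bigcapv => um.
  rewrite mem_bigcapv; apply/allP => H HS; apply: (allP um); rewrite !inE.
  rewrite (fsubsetP SA) //=.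
  by move: vx; rewrite xS mem_bigcapv => /allP; apply.
rewrite sum_mobius ?le0x //; congr (_%:R); congr nat_of_bool.
apply/eqP/allP => [bm H HA|vA].
  apply/negP => vH; case/eqP: (properA _ HA); apply/vspaceP => u; rewrite memvf.
  have : u \in flat_space (\bot : flat A)%O by exact: memvf.
  by rewrite bm mem_bigcapv => /allP; apply; rewrite !inE HA.
apply: val_inj; apply/esym/vspaceP => u; rewrite memvf mem_bigcapv.
by apply/allP => H; rewrite !inE => /andP[/vA/negP].
Qed.

(** Each power of [q] is expanded as a count of points; after exchanging the two sums,
    [sum_mobius_mem] evaluates the inner one at each point. *)
Lemma charpoly_count A (I : finType) (v : I -> 'rV[R]_n) (q : nat) :
    (forall H, H \in A -> H != fullv) ->
    (forall x : flat A,
       #|[pred i | v i \in flat_space x]| = (q ^ \dim (flat_space x))%N) ->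
  (charpoly A).[q%:R] =
    #|[pred i | all (fun H : {vspace _} => v i \notin H) (enum_fset A)]|%:R.
Proof.
move=> properA cardA; rewrite horner_sum.
rewrite (eq_bigr (fun x => \sum_(i | v i \in flat_space x) mobius (\bot : flat A)%O x)).
  rewrite (exchange_big_dep xpredT) //= -sum1_card natr_sum [RHS]big_mkcond /=.
  apply: eq_bigr => i _; rewrite sum_mobius_mem //.
  by rewrite inE; case: all.
move=> x _; rewrite hornerZ hornerXn sumr_const.
by rewrite -natrX -cardA mulr_natr.
Qed.

End Charpoly.

(** * Flats as signed coordinate subspaces *)

Section SignedSpace.
Context {R : realType} {n : nat}.
Implicit Types (V H : {vspace 'rV[R]_n}) (x : 'rV[R]_n).

Definition signs : seq R := [:: 0; 1; -1].

Lemma signs0 : 0 \in signs. Proof. exact: mem_head. Qed.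

Lemma signsM (c c' : R) : c \in signs -> c' \in signs -> c * c' \in signs.
Proof.
by rewrite !inE => /or3P[] /eqP-> /or3P[] /eqP->;
  rewrite ?mul0r ?mulr0 ?mul1r ?mulr1 ?mulN1r ?opprK eqxx ?orbT.
Qed.

Lemma signs_sqr (c : R) : c \in signs -> c != 0 -> c * c = 1.
Proof.
by rewrite !inE => /or3P[] /eqP->; rewrite ?eqxx // ?mulrNN mulr1.
Qed.

(* The coordinates in [B] are free; every other one is 0 or plus or minus a
   free one. *)
Definition signed_param (B : {set 'I_n}) (r : 'I_n -> 'I_n) (s : 'I_n -> R) V :=
  [/\ forall i, i \in B -> r i = i /\ s i = 1,
      forall i, s i \in signs,
      forall i, s i != 0 -> r i \in B
    & forall x, x \in V <-> forall i, x 0 i = s i * x 0 (r i)].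

Definition signed_space V := exists B r s, signed_param B r s V.

(** A form shared by the hyperplanes of all four families: x_i = 0, x_i = x_j or x_i = -x_j. The
    condition on [c], [i] and [j] excludes the trivial equation x_i = x_i. *)
Definition signed_hyperplane H := exists i j c,
  [/\ c \in signs, c = 0 \/ i != j & forall x, (x \in H) = (x 0 i == c * x 0 j)].

(** On [V] the equation of [H] gives the free coordinate [a] as [c] times [b]. So [a] leaves [B],
    and every coordinate that depended on [a] is redirected to [b] with its coefficient multiplied
    by [c]. For [c = 0] the index [b] is a dummy. *)
Lemma signed_param_elim B r s V H (a b : 'I_n) (c : R) :
    signed_param B r s V -> a \in B -> c \in signs ->
    (c != 0 -> b \in B /\ b != a) ->
    (forall x, x \in V -> (x \in H <-> x 0 a = c * x 0 b)) ->
  signed_space (V :&: H)%VS.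
Proof.
move=> [hB hs hr hV] aB cs hc hH.
exists (B :\ a), (fun i => if r i == a then b else r i),
  (fun i => if r i == a then s i * c else s i); split.
- move=> i; rewrite in_setD1 => /andP[ia iB]; have [-> ->] := hB i iB.
  by rewrite (negPf ia).
- by move=> i; case: ifP => _ //; apply: signsM.
- move=> i; case: ifP => [_|/negbT ria si]; last by rewrite in_setD1 ria hr.
  by rewrite mulf_eq0 negb_or => /andP[_ /hc[bB ba]]; rewrite in_setD1 ba.
move=> x; rewrite memv_cap; split.
  move=> /andP[xV /(hH x xV) xa] i; have /hV hx := xV.
  by case: ifP => [/eqP ria|_]; rewrite hx // -mulrA -xa ria.
move=> hx; have xa : x 0 a = c * x 0 b.
  by have := hx a; have [-> ->] := hB a aB; rewrite eqxx mul1r.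
have xV : x \in V.
  apply/(hV x) => i; rewrite hx; case: ifP => [/eqP->|_ //].
  by rewrite -mulrA -xa.
by rewrite xV; apply/(hH x xV).
Qed.

(** Substituting the parametrization turns the equation of [H] into one between multiples of the
    free coordinates [r i] and [r j], with coefficients [s i] and [e]. It is vacuous, kills one free
    coordinate, or expresses one through another. *)
Lemma signed_space_cap V H :
  signed_space V -> signed_hyperplane H -> signed_space (V :&: H)%VS.
Proof.
move=> [B [r [s Vp]]] [i [j [c [cs _ hH]]]]; have [hB hs hr hV] := Vp.
pose e := c * s j; have es : e \in signs by apply: signsM.
have {}hH x : x \in V -> (x \in H) = (s i * x 0 (r i) == e * x 0 (r j)).
  by move=> /hV hx; rewrite hH (hx i) (hx j) -mulrA -!hx.
have eB : e != 0 -> r j \in B by rewrite mulf_eq0 negb_or => /andP[_]; apply: hr.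
have [e0|e0] := eqVneq e 0; have [si0|si0] := eqVneq (s i) 0.
- suff -> : (V :&: H)%VS = V by exists B, r, s.
  apply/vspaceP => x; rewrite memv_cap; case xV: (x \in V) => //=.
  by rewrite hH // e0 si0 !mul0r eqxx.
- apply: (@signed_param_elim B r s V H (r i) (r i) 0); rewrite ?eqxx ?hr ?signs0 //.
  move=> x xV; rewrite hH // e0 !mul0r mulf_eq0 (negPf si0) /=; by split=> /eqP.
- apply: (@signed_param_elim B r s V H (r j) (r j) 0); rewrite ?eqxx ?eB ?signs0 //.
  move=> x xV; rewrite hH // si0 !mul0r eq_sym mulf_eq0 (negPf e0) /=.
  by split=> /eqP.
have [rij|rij] := eqVneq (r j) (r i); last first.
  (* As [s i] is 1 or -1, it is its own inverse, which solves the equation for the coordinate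
     [r i]. *)
  apply: (@signed_param_elim B r s V H (r i) (r j) (s i * e)).
  - exact: Vp.
  - exact: hr.
  - exact: signsM.
  - by move=> _; split; first exact: eB.
  move=> x xV; rewrite hH //; split => [/eqP|->].
    by rewrite -mulrA => <-; rewrite mulrA signs_sqr ?mul1r.
  by rewrite !mulrA signs_sqr ?mul1r.
have [sie|sie] := eqVneq (s i) e.
  suff -> : (V :&: H)%VS = V by exists B, r, s.
  apply/vspaceP => x; rewrite memv_cap; case xV: (x \in V) => //=.
  by rewrite hH // sie rij eqxx.
(* The same free coordinate with two distinct coefficients must vanish. *)
apply: (@signed_param_elim B r s V H (r i) (r i) 0); rewrite ?eqxx ?hr ?signs0 //.
move=> x xV; rewrite hH // rij mul0r -subr_eq0 -mulrBl mulf_eq0 subr_eq0 (negPf sie).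
by split=> /eqP.
Qed.

Lemma signed_space_bigcap (s : seq {vspace 'rV[R]_n}) :
  (forall H, H \in s -> signed_hyperplane H) ->
  signed_space (\bigcap_(H <- s) H)%VS.
Proof.
elim: s => [_|H s IH hs].
  rewrite big_nil; exists setT, id, (fun=> 1); split => //.
  - by move=> i; rewrite !inE eqxx orbT.
  - by move=> i _; rewrite inE.
  - by move=> x; rewrite memvf; split => // _ i; rewrite mul1r.
rewrite big_cons capvC; apply: signed_space_cap; last exact/hs/mem_head.
by apply: IH => K Ks; apply: hs; rewrite inE Ks orbT.
Qed.

(** The basis vector at [i] violates the equation: its [i]-th coordinate is 1, while the right-hand
    side is 0. *)
Lemma signed_hyperplane_proper H : signed_hyperplane H -> H != fullv.
Proof.
move=> [i [j [c [_ cij hH]]]]; apply/eqP => HT.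
have := hH (delta_mx 0 i); rewrite HT memvf !mxE !eqxx /= => /esym.
case: cij => [->|/negPf ij]; first by rewrite mul0r oner_eq0.
by rewrite [j == i]eq_sym ij mulr0 oner_eq0.
Qed.

(** [V] is the image of the linear map [f] that computes all coordinates from the free ones; [f] is
    injective because the free coordinates of [f y] give back [y]. *)
Lemma dim_signed_param B r s V : signed_param B r s V -> \dim V = #|B|.
Proof.
move=> [hB hs hr hV].
pose f (y : 'rV[R]_#|B|) : 'rV[R]_n :=
  \row_i \sum_(k < #|B|) (s i * (enum_val k == r i)%:R) * y 0 k.
have f_lin : linear f.
  move=> a u v; apply/rowP => i; rewrite !mxE mulr_sumr -big_split /=.
  by apply: eq_bigr => k _; rewrite !mxE mulrDr mulrCA.
pose F := GRing.isLinear.Build R 'rV[R]_#|B| 'rV[R]_n *:%R f f_lin.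
pose g : {linear 'rV[R]_#|B| -> 'rV[R]_n} := HB.pack f F.
have fE y i k : r i = enum_val k -> f y 0 i = s i * y 0 k.
  move=> rik; rewrite mxE (bigD1 k) //= rik eqxx mulr1 big1 ?addr0 // => k' kk'.
  by rewrite (inj_eq enum_val_inj) (negPf kk') mulr0 mul0r.
have fE0 y i : s i = 0 -> f y 0 i = 0.
  by move=> si; rewrite mxE big1 // => k _; rewrite si !mul0r.
have fB y k : f y 0 (enum_val k) = y 0 k.
  have [rk sk] := hB _ (enum_valP k).
  by rewrite (fE y _ k) // sk mul1r.
have -> : V = limg (linfun g).
  apply/vspaceP => x; apply/idP/idP => [/hV hx|/memv_imgP[y _ ->]].
    apply/memv_imgP; exists (\row_k x 0 (enum_val k)); first exact: memvf.
    rewrite lfunE /=; apply/rowP => i.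
    have [si|si] := eqVneq (s i) 0; first by rewrite hx si mul0r fE0.
    rewrite (@fE _ i (enum_rank_in (hr i si) (r i))) ?mxE enum_rankK_in ?hr //.
  rewrite lfunE /=; apply/hV => i.
  have [si|si] := eqVneq (s i) 0; first by rewrite si mul0r fE0.
  rewrite -(enum_rankK_in (hr i si) (hr i si)) fB.
  by rewrite (@fE _ i (enum_rank_in (hr i si) (r i))) // enum_rankK_in ?hr.
rewrite limg_dim_eq; first by rewrite dimvf /dim /= mul1n.
apply/eqP; rewrite -subv0; apply/subvP => y.
rewrite memv_cap memv_ker lfunE => /andP[_ /eqP fy].
rewrite memv0; apply/eqP/rowP => k.
by rewrite -fB (fy : f y = 0) !mxE.
Qed.

End SignedSpace.

(** * Flats in the cube *)

Section Cube.
Context {R : realType} {n m : nat}.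
Local Notation cube := 'I_m.*2.+1.

Definition cube_mid : cube := inord m.

(* The point [k] of the cube stands for the integer [k - m]. *)
Definition cube_val (k : cube) : R := k%:R - m%:R.

Definition cube_vec (p : {ffun 'I_n -> cube}) : 'rV[R]_n := \row_i cube_val (p i).

Lemma cube_midE : cube_mid = m :> nat.
Proof. by rewrite inordK // ltnS -addnn leq_addr. Qed.

Lemma rev_cube_mid : rev_ord cube_mid = cube_mid.
Proof. by apply: val_inj; rewrite /= cube_midE subSS -addnn addnK. Qed.

Lemma cube_val_inj : injective cube_val.
Proof. by move=> k l /addIr /eqP; rewrite eqr_nat => /eqP/val_inj. Qed.

Lemma cube_val_rev k : cube_val (rev_ord k) = - cube_val k.
Proof.
have km : (k <= m.*2)%N by rewrite -ltnS.
have m2 : m.*2%:R = m%:R + m%:R :> R by rewrite -addnn natrD.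
by rewrite /cube_val /= subSS natrB // m2; ring.
Qed.

Lemma cube_val_eq0 k : (cube_val k == 0) = (k == cube_mid).
Proof. by rewrite subr_eq0 eqr_nat -val_eqE /= cube_midE. Qed.

Lemma cube_val_eqN k l : (cube_val k == - cube_val l) = (k == rev_ord l).
Proof. by rewrite -cube_val_rev (inj_eq cube_val_inj). Qed.

(** Multiplication by an element of [signs], carried over to the cube; the last branch is meant for
    -1. *)
Definition cube_scale (c : R) (k : cube) : cube :=
  if c == 0 then cube_mid else if c == 1 then k else rev_ord k.

Lemma cube_val_scale c k :
  c \in signs -> cube_val (cube_scale c k) = c * cube_val k.
Proof.
rewrite /cube_scale !inE => /or3P[] /eqP->; rewrite ?eqxx ?oner_eq0 ?oppr_eq0 ?oner_eq0.
- by rewrite mul0r; apply/eqP; rewrite cube_val_eq0.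
- by rewrite mul1r.
- have /negPf-> : -1 != 1 :> R by rewrite -subr_eq0 -opprD oppr_eq0 (pnatr_eq0 R 2).
  by rewrite mulN1r cube_val_rev.
Qed.

(** The free coordinates range over the whole cube independently, and scaling by 0, 1 or -1 keeps
    the others inside it. The set [D] encodes the choices of free coordinates, set to [cube_mid]
    outside [B], and [g] maps it bijectively onto the points of [V]. *)
Lemma card_cube_signed_space V : signed_space V ->
  #|[pred p | cube_vec p \in V]| = (m.*2.+1 ^ \dim V)%N.
Proof.
move=> [B [r [s Vp]]]; rewrite (dim_signed_param Vp); have [hB hs hr hV] := Vp.
pose D := pffun_on cube_mid (mem B) (mem (@predT cube)).
have DP (h : {ffun 'I_n -> cube}) :
    h \in D <-> (forall i, i \notin B -> h i = cube_mid).
  split=> [/(@pffun_onP _ _ cube_mid (mem B) (mem predT))[/supportP//]|hB'].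
  by apply/(@pffun_onP _ _ cube_mid (mem B) (mem predT)); split=> //; apply/supportP.
have -> : (m.*2.+1 ^ #|B|)%N = #|D|.
  by rewrite (card_pffun_on cube_mid (mem B) (mem predT)) card_ord.
pose g (h : {ffun 'I_n -> cube}) := [ffun i => cube_scale (s i) (h (r i))].
have gB h i : i \in B -> g h i = h i.
  by move=> /hB[ri si]; rewrite ffunE ri si /cube_scale oner_eq0 eqxx.
have VP p : p \in [pred p | cube_vec p \in V] <->
    forall i, p i = cube_scale (s i) (p (r i)).
  rewrite inE /=; split=> [/hV hp i|hp].
    apply: cube_val_inj; rewrite cube_val_scale //.
    by have := hp i; rewrite !mxE.
  by apply/hV => i; rewrite !mxE {1}hp cube_val_scale.
have <- : #|image g D| = #|D|.
  apply: card_in_image => h h' /DP hD /DP hD' gg.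
  apply/ffunP => i; have [iB|iB] := boolP (i \in B); last by rewrite hD ?hD'.
  by rewrite -gB // gg gB.
apply: eq_card => p; apply/idP/imageP => [/VP hp|[h hh ->]].
  (* The preimage keeps the free coordinates and resets the others to the default value. *)
  exists [ffun i => if i \in B then p i else cube_mid].
    by apply/DP => i iB; rewrite ffunE (negPf iB).
  apply/ffunP => i; rewrite !ffunE; case: ifPn => [_|riB]; first exact: hp.
  have si : s i == 0 by apply: contraR riB => /hr.
  by rewrite hp /cube_scale si.
apply/VP => i; rewrite ffunE.
have [si|si] := eqVneq (s i) 0; first by rewrite /cube_scale si eqxx.
by rewrite gB ?hr.
Qed.

End Cube.

(** * Avoiding the arrangements *)

Section Families.
Context {R : realType} {n : nat}.

Lemma signed_hyperplane_family F H :
  H \in family_arr R n F -> signed_hyperplane H.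
Proof.
have coord (K : {vspace 'rV[R]_n}) i : (forall x, (x \in K) = (x 0 i == 0)) ->
    signed_hyperplane K.
  move=> hK; exists i, i, 0; split; [exact: signs0 | by left |].
  by move=> x; rewrite hK mul0r.
have add (i j : 'I_n) : (i < j)%N ->
    signed_hyperplane (hyperplane (fun x : 'rV[R]_n => x 0 i + x 0 j)).
  move=> ij; exists i, j, (-1); split; first by rewrite !inE eqxx !orbT.
    by right; rewrite -val_eqE ltn_eqF.
  by move=> x; rewrite mem_hyperplane_add addr_eq0 mulN1r.
have sub (i j : 'I_n) : (i < j)%N ->
    signed_hyperplane (hyperplane (fun x : 'rV[R]_n => x 0 i - x 0 j)).
  move=> ij; exists i, j, 1; split; first by rewrite !inE eqxx !orbT.
    by right; rewrite -val_eqE ltn_eqF.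
  by move=> x; rewrite mem_hyperplane_sub subr_eq0 mul1r.
case: F => /=; rewrite ?in_fsetU.
- case/orP => [/orP[]|] /imfsetP[p /= hp ->]; [|exact: add|exact: sub].
  by apply: (coord _ p) => x; rewrite mem_hyperplane_double mulf_eq0 pnatr_eq0.
- by case/imfsetP=> i _ ->; apply: (coord _ i) => x; rewrite mem_hyperplane_coord.
- by case/orP => /imfsetP[p /= hp ->]; [exact: add|exact: sub].
- by case/imfsetP=> p /= hp ->; exact: sub.
Qed.

Lemma signed_space_flat F (x : flat (family_arr R n F)) :
  signed_space (flat_space x).
Proof.
have [S /fsubsetP SA ->] := flatP x.
by apply: signed_space_bigcap => H /SA; apply: signed_hyperplane_family.
Qed.

End Families.

Section Avoid.
Context {n m : nat}.
Implicit Type p : {ffun 'I_n -> 'I_m.*2.+1}.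

Definition avoid_zero p := [forall i, p i != cube_mid].
Definition avoid_sub p := [forall i : 'I_n, forall j : 'I_n, (i < j)%N ==> (p i != p j)].
Definition avoid_add p :=
  [forall i : 'I_n, forall j : 'I_n, (i < j)%N ==> (p i != rev_ord (p j))].

Definition avoid F p :=
  match F with
  | TypeC => avoid_zero p && (avoid_add p && avoid_sub p)
  | Boolean => avoid_zero p
  | TypeD => avoid_add p && avoid_sub p
  | Braid => avoid_sub p
  end.

Lemma avoid_family (R : realType) F p :
  all (fun H : {vspace _} => cube_vec p \notin H) (enum_fset (family_arr R n F)) =
    avoid F p.
Proof.
have allU (P : pred {vspace 'rV[R]_n}) (A B : {fset {vspace 'rV[R]_n}}) :
    all P (enum_fset (A `|` B)) = all P (enum_fset A) && all P (enum_fset B).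
  apply/allP/andP => [h|[/allP hA /allP hB] H].
    by split; apply/allP => H HA; apply: h; rewrite in_fsetU HA ?orbT.
  by rewrite in_fsetU => /orP[/hA|/hB].
have all_sub : all (fun H : {vspace _} => cube_vec p \notin H)
   (enum_fset [fset hyperplane (fun x : 'rV[R]_n => x 0 q.1 - x 0 q.2) |
        q : 'I_n * 'I_n & (q.1 < q.2)%N]) = avoid_sub p.
  have hyp i j : (cube_vec p \notin hyperplane (fun x : 'rV[R]_n => x 0 i - x 0 j))
      = (p i != p j).
    by rewrite mem_hyperplane_sub !mxE subr_eq0 (inj_eq cube_val_inj).
  apply/allP/forallP => [h i|h H /imfsetP[q /= hq ->]].
    apply/forallP => j; apply/implyP => ij; rewrite -hyp; apply: h.
    by apply/imfsetP; exists (i, j).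
  by rewrite hyp; have /forallP/(_ q.2)/implyP := h q.1; apply.
have all_add : all (fun H : {vspace _} => cube_vec p \notin H)
   (enum_fset [fset hyperplane (fun x : 'rV[R]_n => x 0 q.1 + x 0 q.2) |
        q : 'I_n * 'I_n & (q.1 < q.2)%N]) = avoid_add p.
  have hyp i j : (cube_vec p \notin hyperplane (fun x : 'rV[R]_n => x 0 i + x 0 j))
      = (p i != rev_ord (p j)).
    by rewrite mem_hyperplane_add !mxE addr_eq0 cube_val_eqN.
  apply/allP/forallP => [h i|h H /imfsetP[q /= hq ->]].
    apply/forallP => j; apply/implyP => ij; rewrite -hyp; apply: h.
    by apply/imfsetP; exists (i, j).
  by rewrite hyp; have /forallP/(_ q.2)/implyP := h q.1; apply.
have all_zero (f : 'I_n -> {vspace 'rV[R]_n}) :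
    (forall i x, (x \in f i) = (x 0 i == 0)) ->
    all (fun H : {vspace _} => cube_vec p \notin H)
      (enum_fset [fset f i | i : 'I_n]) = avoid_zero p.
  move=> hf; have hyp i : (cube_vec p \notin f i) = (p i != cube_mid).
    by rewrite hf mxE cube_val_eq0.
  apply/allP/forallP => [h i|h H /imfsetP[i /= _ ->]]; last by rewrite hyp.
  by rewrite -hyp; apply: h; apply/imfsetP; exists i.
case: F => /=.
- rewrite !allU all_sub all_add all_zero ?andbA // => i x.
  by rewrite mem_hyperplane_double mulf_eq0 pnatr_eq0.
- by rewrite all_zero // => i x; rewrite mem_hyperplane_coord.
- by rewrite allU all_sub all_add.
- by rewrite all_sub.
Qed.

End Avoid.

Lemma charpoly_family (R : realType) (n m : nat) F :
  (charpoly (family_arr R n F)).[m.*2.+1%:R] =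
    #|[pred p : {ffun 'I_n -> 'I_m.*2.+1} | avoid F p]|%:R.
Proof.
rewrite (@charpoly_count _ _ _ _ (@cube_vec R n m)).
- by congr (_%:R); apply: eq_card => p; rewrite !inE avoid_family.
- by move=> H /signed_hyperplane_family/signed_hyperplane_proper.
- by move=> x; apply/card_cube_signed_space/signed_space_flat.
Qed.

(** * Counting the points off an arrangement *)

Section FunctionCons.
Context {T : finType} {n : nat}.
Implicit Types (x : T) (g : {ffun 'I_n -> T}) (p : {ffun 'I_n.+1 -> T}).

Definition fcons x g : {ffun 'I_n.+1 -> T} :=
  [ffun i => oapp g x (unlift ord0 i)].

Lemma fcons0 x g : fcons x g ord0 = x.
Proof. by rewrite ffunE unlift_none. Qed.

Lemma fconsS x g j : fcons x g (lift ord0 j) = g j.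
Proof. by rewrite ffunE liftK. Qed.

Lemma big_fcons {V : nmodType} (P : pred {ffun 'I_n.+1 -> T})
    (G : {ffun 'I_n.+1 -> T} -> V) :
  \sum_(p | P p) G p = \sum_(x : T) \sum_(g | P (fcons x g)) G (fcons x g).
Proof.
pose h p : T * {ffun 'I_n -> T} := (p ord0, [ffun j => p (lift ord0 j)]).
rewrite pair_big_dep /= (reindex (fun u : T * {ffun 'I_n -> T} => fcons u.1 u.2)) //.
exists h => [[x g] _|p _]; rewrite /h /=.
  by congr (_, _); [rewrite fcons0 | apply/ffunP => j; rewrite ffunE fconsS].
by apply/ffunP => i; rewrite ffunE; case: unliftP => [j ->|->] //=; rewrite ffunE.
Qed.

Lemma forall_ordS (P : pred 'I_n.+1) :
  [forall i, P i] = P ord0 && [forall j : 'I_n, P (lift ord0 j)].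
Proof.
apply/forallP/andP => [h|[h0 /forallP h] i]; first by split=> //; apply/forallP.
by case: (unliftP ord0 i) => [j ->|->].
Qed.

End FunctionCons.

Section CountAvoid.
Context {m : nat}.
Local Notation cube := 'I_m.*2.+1.
Local Notation q := (m.*2.+1%:R : int).

Lemma card_avoid0 F :
  #|[pred p : {ffun 'I_0 -> cube} | avoid F p]| = 1%N.
Proof.
rewrite (@eq_card _ _ predT); first by rewrite card_ffun !card_ord expn0.
move=> p; rewrite !inE /=.
have z : avoid_zero p by apply/forallP => -[].
have s : avoid_sub p by apply/forallP => -[].
have a : avoid_add p by apply/forallP => -[].
by case: F; rewrite /= ?z ?s ?a.
Qed.

Section Step.
Context {n : nat}.
Implicit Types (x : cube) (g : {ffun 'I_n -> cube}).

Lemma avoid_zero_cons x g : avoid_zero (fcons x g) = (x != cube_mid) && avoid_zero g.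
Proof.
rewrite /avoid_zero forall_ordS fcons0; congr (_ && _).
by apply: eq_forallb => i; rewrite fconsS.
Qed.

Lemma avoid_sub_cons x g : avoid_sub (fcons x g) = (x \notin codom g) && avoid_sub g.
Proof.
rewrite /avoid_sub forall_ordS forall_ordS fcons0 /=; congr (_ && _).
  apply/forallP/negP => [h /codomP[j xj]|h j].
    by have := h j; rewrite fconsS xj eqxx.
  by rewrite fconsS; apply/eqP => xj; apply: h; rewrite xj codom_f.
apply: eq_forallb => i; rewrite forall_ordS /=.
by apply: eq_forallb => j; rewrite !fconsS.
Qed.

Lemma avoid_add_cons x g :
  avoid_add (fcons x g) = (rev_ord x \notin codom g) && avoid_add g.
Proof.
rewrite /avoid_add forall_ordS forall_ordS fcons0 /=; congr (_ && _).
  apply/forallP/negP => [h /codomP[j xj]|h j].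
    by have := h j; rewrite fconsS -xj rev_ordK eqxx.
  by rewrite fconsS; apply/eqP => xj; apply: h; rewrite xj rev_ordK codom_f.
apply: eq_forallb => i; rewrite forall_ordS /=.
by apply: eq_forallb => j; rewrite !fconsS.
Qed.

Lemma avoid_zeroE g : avoid_zero g = (cube_mid \notin codom g).
Proof.
apply/forallP/negP => [h /codomP[j xj]|h j]; first by have := h j; rewrite xj eqxx.
by apply/eqP => gj; apply: h; rewrite -gj codom_f.
Qed.

Lemma avoid_sub_uniq g : avoid_sub g -> uniq (codom g).
Proof.
move=> /forallP h; apply/injectiveP => i j gij.
by have /forallP/(_ j) := h i; have /forallP/(_ i) := h j;
  rewrite gij eqxx !implybF; case: ltngtP => // /val_inj.
Qed.

Lemma card_notin (s : seq cube) :
  uniq s -> (#|[pred x | x \notin s]|%:R : int) = q - (size s)%:R.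
Proof.
move=> s_uniq; have e : (size s + #|[pred x | x \notin s]| = m.*2.+1)%N.
  by rewrite -(card_uniqP s_uniq) -[RHS]card_ord -(cardC [in s]).
have -> : q = (size s)%:R + #|[pred x | x \notin s]|%:R by rewrite -natrD e.
by rewrite addrAC subrr add0r.
Qed.

Lemma rev_ord_id x : rev_ord x = x -> x = cube_mid.
Proof.
move=> /(congr1 val) /= h; apply: val_inj; rewrite /= cube_midE.
by have := ltn_ord x; lia.
Qed.

(* [rev_ord] fixes [cube_mid], which is filtered out so that [used g] has no
   repetition when [g] avoids the type D arrangement. *)
Definition used g := codom g ++ [seq rev_ord x | x <- codom g & x != cube_mid].

Lemma uniq_used g : avoid_add g -> avoid_sub g -> uniq (used g).
Proof.
move=> /forallP ha hs; rewrite cat_uniq avoid_sub_uniq //=.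
rewrite (map_inj_uniq rev_ord_inj) filter_uniq ?avoid_sub_uniq // andbT.
apply/hasPn => y /mapP[x]; rewrite mem_filter => /andP[x0 /codomP[i xi]] ->.
apply/negP => /codomP[j].
(* A value at [j] opposite to the value at [i] contradicts [avoid_add] if the positions differ; if
   they coincide, the value is its own opposite, hence the filtered [cube_mid]. *)
have [ij|ji|/val_inj ij] := ltngtP i j.
- move=> xj; have /forallP/(_ j) := ha i.
  by rewrite ij -xj rev_ordK xi eqxx.
- move=> xj; have /forallP/(_ i) := ha j.
  by rewrite ji -xj xi eqxx.
- by rewrite -ij -xi => /rev_ord_id x_mid; rewrite x_mid eqxx in x0.
Qed.

(** The filter loses nothing: [cube_mid] is its own opposite, so it is already in [codom g] when its
    opposite is. *)
Lemma mem_used g x : (x \in used g) = (x \in codom g) || (rev_ord x \in codom g).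
Proof.
rewrite mem_cat; case xg: (x \in codom g) => //=.
apply/mapP/idP => [[y]|rx].
  by rewrite mem_filter => /andP[_ yg] ->; rewrite rev_ordK.
exists (rev_ord x); rewrite ?rev_ordK // mem_filter rx andbT.
apply: contraFN xg => /eqP x_mid.
by rewrite -(rev_ordK x) x_mid rev_cube_mid -x_mid.
Qed.

(** There are [n] values and [n] opposites, less one opposite if [cube_mid] occurs; by [avoid_sub]
    it occurs at most once. *)
Lemma size_used g :
  avoid_sub g -> (size (used g))%:R = n.*2%:R - (cube_mid \in codom g)%:R :> int.
Proof.
move=> hs; rewrite -(addnn n) size_cat size_map size_filter size_codom card_ord.
have := count_predC (pred1 cube_mid) (codom g).
rewrite (count_uniq_mem _ (avoid_sub_uniq hs)) size_codom card_ord => e.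
apply/eqP; rewrite eq_sym subr_eq -natrD -addnA; apply/eqP; congr (n + _)%:R.
by rewrite addnC; exact: esym e.
Qed.

Definition forbidden F g :=
  match F with
  | TypeC => cube_mid :: used g
  | Boolean => [:: cube_mid]
  | TypeD => used g
  | Braid => codom g
  end.

Lemma avoid_cons F x g : avoid F (fcons x g) = avoid F g && (x \notin forbidden F g).
Proof.
case: F => /=; rewrite ?avoid_zero_cons ?avoid_add_cons ?avoid_sub_cons
    ?in_cons ?mem_used ?negb_or ?orbF.
- by case: avoid_zero; case: avoid_add; case: avoid_sub; case: (x \in codom g);
    case: (_ \in codom g); rewrite ?andbF ?andbT.
- by rewrite in_nil andbT andbC.
- by case: avoid_add; case: avoid_sub; case: (x \in codom g);
    case: (_ \in codom g).
- by rewrite andbC.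
Qed.

Lemma uniq_forbidden F g : avoid F g -> uniq (forbidden F g).
Proof.
case: F => /=; last exact: avoid_sub_uniq.
- move=> /and3P[g0 ga gs]; rewrite uniq_used // andbT.
  by rewrite mem_used rev_cube_mid orbb -avoid_zeroE.
- by [].
- by move=> /andP[]; exact: uniq_used.
Qed.

Lemma card_avoidS F :
  (#|[pred p : {ffun 'I_n.+1 -> cube} | avoid F p]|%:R : int) =
    \sum_(g : {ffun 'I_n -> cube} | avoid F g) (q - (size (forbidden F g))%:R).
Proof.
rewrite -sum1_card natr_sum big_fcons (exchange_big_dep (avoid F)) /=; last first.
  by move=> x g _; rewrite inE avoid_cons => /andP[].
apply: eq_bigr => g gF; rewrite -card_notin ?uniq_forbidden // -sum1_card natr_sum.
by apply: eq_bigl => x; rewrite !inE avoid_cons gF.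
Qed.

(** This serves every family except type D, where the number of forbidden values depends on whether
    [g] takes the value [cube_mid]. *)
Lemma card_avoidS_const F a :
    (forall g, avoid F g -> (size (forbidden F g))%:R = a%:R :> int) ->
  (#|[pred p : {ffun 'I_n.+1 -> cube} | avoid F p]|%:R : int) =
    #|[pred g : {ffun 'I_n -> cube} | avoid F g]|%:R * (q - a%:R).
Proof.
move=> h; rewrite card_avoidS (eq_bigr (fun=> q - a%:R)); last by move=> g /h ->.
by rewrite sumr_const mulr_natl.
Qed.

Lemma card_avoidS_TypeC :
  (#|[pred p : {ffun 'I_n.+1 -> cube} | avoid TypeC p]|%:R : int) =
    #|[pred g : {ffun 'I_n -> cube} | avoid TypeC g]|%:R * (q - n.*2.+1%:R).
Proof.
apply: card_avoidS_const => g /and3P[g0 _ gs] /=.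
rewrite -(natr1 (size _)) size_used // -(natr1 _.*2).
by rewrite -[cube_mid \in _]negbK -avoid_zeroE g0 /=; ring.
Qed.

End Step.

(** The exponents of the arrangement. For type D and [n = 0] the list is [[:: 0]] rather than empty,
    hence the assumption [0 < n] in the product formulas. *)
Definition char_roots F n : seq nat :=
  match F with
  | TypeC => [seq i.*2.+1 | i <- iota 0 n]
  | Boolean => nseq n 1%N
  | TypeD => n.-1 :: [seq i.*2.+1 | i <- iota 0 n.-1]
  | Braid => iota 0 n
  end.

(** Write D_k and C_k for the numbers of points off the two arrangements. A type D point leaves q -
    2k + 1 choices for a new coordinate, less one if it has no zero coordinate, that is, if it is a
    type C point. So D_(k+1) = D_k (q - 2k + 1) - C_k. *)
Lemma card_avoid_TypeD n :
  (#|[pred p : {ffun 'I_n.+1 -> cube} | avoid TypeD p]|%:R : int) =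
  #|[pred p : {ffun 'I_n -> cube} | avoid TypeC p]|%:R * (q - n%:R).
Proof.
have rec k : (#|[pred p : {ffun 'I_k.+1 -> cube} | avoid TypeD p]|%:R : int) =
    #|[pred p : {ffun 'I_k -> cube} | avoid TypeD p]|%:R * (q - k.*2%:R + 1)
     - #|[pred p : {ffun 'I_k -> cube} | avoid TypeC p]|%:R.
  rewrite card_avoidS -!sum1_card !natr_sum mulr_suml [X in _ - X]big_mkcond.
  rewrite [X in X - _](eq_bigl (avoid TypeD)) // [X in _ - X](_ : _ =
    \sum_(g : {ffun 'I_k -> cube} | avoid TypeD g) (avoid_zero g)%:R); last first.
    rewrite [RHS]big_mkcond; apply: eq_bigr => g _; rewrite !inE /=.
    by case: avoid_zero; case: ifP.
  rewrite -sumrB; apply: eq_bigr => g /andP[_ gs].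
  rewrite size_used // avoid_zeroE.
  by case: (_ \in _) => /=; rewrite ?mulr1n ?mulr0n; ring.
elim: n => [|n IH]; first by rewrite rec !card_avoid0 double0; ring.
have n2 : n.+1.*2%:R = n%:R + n%:R + 2 :> int by rewrite -!natrD addnn doubleS addn2.
(* The common factor C_n leaves (q - n)(q - 2n - 1) - (q - 2n - 1) = (q - 2n - 1)(q - n - 1). *)
rewrite rec IH card_avoidS_TypeC -(natr1 n.*2) -(natr1 n) n2 -(addnn n) natrD.
ring.
Qed.

Lemma card_avoid F n : (0 < n)%N ->
  (#|[pred p : {ffun 'I_n -> cube} | avoid F p]|%:R : int) =
    \prod_(a <- char_roots F n) (q - a%:R).
Proof.
have C k : (#|[pred p : {ffun 'I_k -> cube} | avoid TypeC p]|%:R : int) =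
    \prod_(a <- char_roots TypeC k) (q - a%:R).
  elim: k => [|k IH]; first by rewrite card_avoid0 big_nil.
  by rewrite card_avoidS_TypeC IH /char_roots -[k.+1]addn1 iotaD map_cat big_cat /=
    big_seq1.
case: F => n0; first exact: C.
- elim: n {n0} => [|k IH]; first by rewrite card_avoid0 big_nil.
  by rewrite (@card_avoidS_const _ _ 1%N) // big_cons IH mulrC.
- by case: n n0 => // n _; rewrite card_avoid_TypeD big_cons C mulrC.
- elim: n {n0} => [|k IH]; first by rewrite card_avoid0 big_nil.
  rewrite (@card_avoidS_const _ _ k).
    by rewrite IH /char_roots -[k.+1]addn1 iotaD big_cat /= big_seq1.
  by move=> g _; rewrite /= size_codom card_ord.
Qed.

End CountAvoid.

(** * Signed permutations *)

(** The difference of the two sides vanishes at all odd numbers 2m+1; [size p] of them are more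
    roots than a nonzero [p] can have. *)
Lemma charpoly_family_prod (R : realType) (n : nat) F : (0 < n)%N ->
  charpoly (family_arr R n F) = \prod_(a <- char_roots F n) ('X - a%:R%:P).
Proof.
move=> n0; apply/eqP; rewrite -subr_eq0; set p := _ - _.
have p0 m : root p m.*2.+1%:R.
  rewrite /root /p hornerD hornerN charpoly_family card_avoid // horner_prod.
  by under [X in _ - X]eq_bigr do rewrite !hornerE; rewrite subrr.
apply: contraT => /max_poly_roots.
move=> /(_ [seq (m.*2.+1%:R : int) | m <- iota 0 (size p)]).
rewrite size_map size_iota ltnn; apply.
  by apply/allP => _ /mapP[m _ ->].
rewrite map_inj_uniq ?iota_uniq // => k l /eqP.
by rewrite eqr_nat => /eqP[] /double_inj.
Qed.

(** Replacing X by -X turns each factor X - a into -(X + a), so coefficients change only by a sign,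
    which the absolute value will remove. *)
Lemma coef_prod_roots (s : seq nat) j :
  (\prod_(a <- s) ('X - a%:R%:P) : {poly int})`_j =
    (-1) ^+ (size s + j) * (\prod_(a <- s) ('X + a%:R%:P) : {poly int})`_j.
Proof.
elim: s j => [|a s IH] j.
  by rewrite !big_nil coef1; case: j => [|j]; rewrite ?mulr0 ?expr0 ?mulr1.
rewrite !big_cons mulrBl mulrDl coefB coefD !coefXM !coefCM !IH /=.
case: j => [|j] /=; first by rewrite addSn exprS; ring.
by rewrite addSn addnS !exprS; ring.
Qed.

(** * Positive compartments as positive right-to-left minima *)

Section RightToLeftMinima.
Context {n : nat}.
Implicit Types (s u v : seq ('I_n * bool)) (a b : 'I_n * bool).

(** Right-to-left minima with positive sign; the last entry is always a minimum, as [all] is true on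
    the empty sequence. *)
Fixpoint positive_minima s : nat :=
  if s is a :: s' then
    (a.2 && all (fun b => a.1 < b.1)%N s') + positive_minima s'
  else 0.

(** No entry of [u] is a right-to-left minimum, because [a] comes later and is not larger. *)
Lemma positive_minima_cat u a v :
  all (fun b => a.1 <= b.1)%N u ->
  positive_minima (u ++ a :: v) = positive_minima (a :: v).
Proof.
elim: u => //= b u IH /andP[ab /IH ->].
by rewrite all_cat /= [(b.1 < a.1)%N]ltnNge ab andbF /= andbF add0n.
Qed.

(** Guarantees that the [find] in [least_pos] succeeds. *)
Lemma exists_least s :
  s != [::] -> has (fun a => all (fun b => a.1 <= b.1)%N s) s.
Proof.
elim: s => // a [|c s] IH _; first by rewrite /= leqnn.
have /hasP[b bs /allP hb] := IH isT.
apply/hasP; have [ab|ba] := leqP a.1 b.1.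
  exists a; first exact: mem_head.
  by apply/allP => d; rewrite inE => /predU1P[-> //|/hb]; apply: leq_trans.
exists b; first by rewrite inE bs orbT.
by apply/allP => d; rewrite inE => /predU1P[->|/hb //]; apply: ltnW.
Qed.

(** The first compartment ends at the least entry [c]. Nothing before [c] is a right-to-left minimum
    and [c] is one, so both counts gain the sign of [c] and continue after it. *)
Lemma count_positive_compartments s : uniq (map fst s) ->
  count positive (compartments s) = positive_minima s.
Proof.
have [k] := ubnP (size s); elim: k s => // k IH [|a0 s] sk.
  by rewrite compartmentsE.
rewrite compartmentsE; move: (a0 :: s) (isT : a0 :: s != [::]) sk => {a0}s s0 sk s_uniq.
have /[dup] least_ltn := exists_least s0.
rewrite has_find -/(least_pos s) => lt_s; set p := least_pos s.
have [a _] := hasP least_ltn.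
move=> _; have /allP := nth_find a least_ltn.
rewrite -/(least_pos s) -/p; set c := nth a s p => c_le.
have ds : drop p s = c :: drop p.+1 s by rewrite (drop_nth a).
rewrite (take_nth a) // /= IH; first last.
- by move: s_uniq; rewrite -{1}(cat_take_drop p.+1 s) map_cat cat_uniq => /and3P[].
- by rewrite size_drop; move: sk lt_s; clear; lia.
rewrite -/c /positive map_rcons last_rcons.
rewrite -[in RHS](cat_take_drop p s) ds positive_minima_cat /=; last first.
  by apply/allP => b /mem_take/c_le.
congr (nat_of_bool _ + _)%N; case: c.2 => //=; apply/esym/allP => b bd.
(* Leastness gives only a weak inequality; distinctness of the entries makes it strict. *)
rewrite ltn_neqAle c_le ?(mem_drop bd) // andbT.
move: s_uniq; rewrite -(cat_take_drop p s) ds map_cat cat_uniq.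
move=> /and3P[_ _] /= /andP[cd _].
by apply: contraNneq cd => /val_inj ->; apply: map_f.
Qed.

End RightToLeftMinima.

Lemma positive_minima_map n n' (f : 'I_n -> 'I_n') (s : seq ('I_n * bool)) :
  {mono f : i j / (i < j)%N} ->
  positive_minima [seq (f a.1, a.2) | a <- s] = positive_minima s.
Proof.
move=> hf; elim: s => //= a s ->; rewrite all_map.
by congr ((_ && _) + _)%N; apply: eq_all => b /=; rewrite hf.
Qed.

Lemma num_positiveE n (w : signed_perm n) : num_positive w = positive_minima (one_line w).
Proof.
apply: count_positive_compartments; rewrite -map_comp map_inj_uniq ?enum_uniq //.
exact: perm_inj.
Qed.

(** * Removing the first entry of a signed permutation *)

Section SignedPermCons.
Context {n : nat}.
Implicit Types (k : 'I_n.+1) (e : bool) (w : signed_perm n).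

(** [lift_perm] raises the tail entries that are at least the new first entry, so their relative
    order is kept. *)
Definition sp_cons (u : ('I_n.+1 * bool) * signed_perm n) : signed_perm n.+1 :=
  (lift_perm ord0 u.1.1 u.2.1, fcons u.1.2 u.2.2).

(** Head and tail can be read off, and both types have (n+1)! 2^(n+1) elements. *)
Lemma sp_cons_bij : bijective sp_cons.
Proof.
apply: inj_card_bij => [[[k e] [s g]] [[k' e'] [s' g']] []|].
  rewrite /= => hs hg.
  have kk : k = k' by rewrite -(lift_perm_id ord0 k s) hs lift_perm_id.
  have ee : e = e' by rewrite -(fcons0 e g) hg fcons0.
  have gg : g = g' by apply/ffunP => j; rewrite -(fconsS e) hg fconsS.
  have ss : s = s'.
    apply/permP => j; apply: (@lift_inj _ k).
    by rewrite -(lift_perm_lift ord0) hs kk lift_perm_lift.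
  by rewrite kk ee gg ss.
rewrite !card_prod !card_ffun !card_Sn !card_ord card_bool factS expnS.
by rewrite -!mulnA leq_mul2l /= mulnCA.
Qed.

(** The first entry is a right-to-left minimum exactly when it is the least value, and relabelling
    the tail in an order-preserving way keeps its minima. *)
Lemma num_positive_cons k e w :
  num_positive (sp_cons (k, e, w)) = ((e && (k == ord0)) + num_positive w)%N.
Proof.
rewrite !num_positiveE; have -> : one_line (sp_cons (k, e, w)) =
    (k, e) :: [seq (lift k a.1, a.2) | a <- one_line w].
  rewrite /one_line enum_ordSl /= lift_perm_id fcons0; congr (_ :: _).
  by rewrite -!map_comp; apply: eq_map => i /=; rewrite lift_perm_lift fconsS.
rewrite /= positive_minima_map; last by move=> i j /=; rewrite /bump; lia.
congr ((_ && _) + _)%N; rewrite -map_comp all_map.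
have [->|k0] := eqVneq k ord0; first by apply/allP => i _.
apply/allPn; case: n k w k0 => [|n'] k w k0; first by case/eqP: k0; apply: ord1.
(* The position of the least tail entry, which stays 0 after lifting past [k] and is thus below
   [k]. *)
exists ((w.1^-1)%g ord0); first by rewrite mem_enum.
by rewrite /= permKV /bump leqn0 -[k == 0 :> nat]/(k == ord0) (negPf k0).
Qed.

Definition allowed F k e :=
  match F with
  | TypeC => true
  | Boolean => k == ord0
  | TypeD | Braid => e
  end.

(** Type D restricts only the first sign, so its tail is an arbitrary signed permutation. *)
Definition tail_family F := if F is TypeD then TypeC else F.

Lemma family_signed_cons F k e w :
  family_signed F (sp_cons (k, e, w)) =
    allowed F k e && family_signed (tail_family F) w.
Proof.
case: F => //=.
- rewrite forall_ordS lift_perm_id; case: eqP => //= ->.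
  by apply: eq_forallb => j; rewrite lift_perm_lift (inj_eq lift_inj).
- rewrite forall_ordS /= fcons0; apply: andb_id2l => _.
  by apply/forallP.
- rewrite forall_ordS fcons0; congr (_ && _).
  by apply: eq_forallb => j; rewrite fconsS.
Qed.

End SignedPermCons.

(** * Generating function of the number of positive compartments *)

Definition positive_enum n F : {poly int} :=
  \sum_(w : signed_perm n | family_signed F w) 'X^(num_positive w).

(** The number of allowed pairs other than [(ord0, true)], the only pair that adds a positive
    compartment; it is allowed in every family. *)
Definition step_root F n : nat :=
  match F with TypeC => n.*2.+1 | Boolean => 1 | TypeD | Braid => n end.

Lemma sum_allowed n F :
  \sum_(v : 'I_n.+1 * bool | allowed F v.1 v.2) 'X^(v.2 && (v.1 == ord0)) =
    'X + (step_root F n)%:R%:P :> {poly int}.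
Proof.
rewrite -(pair_big_dep xpredT (@allowed n F)
  (fun k (e : bool) => 'X^(e && (k == ord0)) : {poly int})) /=.
under eq_bigr => k _ do rewrite big_mkcond big_bool /= expr0.
have sumX : \sum_(k < n.+1) 'X^(k == ord0) = 'X + n%:R :> {poly int}.
  rewrite big_ord_recl eqxx expr1 (eq_bigr (fun=> 1)) => [|k _]; last by rewrite expr0.
  by rewrite sumr_const card_ord.
rewrite polyC_natr; case: F => /=.
- by rewrite big_split /= sumX sumr_const card_ord -addrA -natrD addnS addnn.
- rewrite (bigD1 ord0) //= big1 ?addr0 ?expr1 // => k /negPf->.
  by rewrite addr0.
- by under eq_bigr do rewrite addr0.
- by under eq_bigr do rewrite addr0.
Qed.

Lemma positive_enumS n F :
  positive_enum n.+1 F =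
    ('X + (step_root F n)%:R%:P) * positive_enum n (tail_family F).
Proof.
rewrite -sum_allowed big_distrlr /= pair_big /= /positive_enum.
rewrite (reindex _ (onW_bij _ sp_cons_bij)) /=.
apply: eq_big => [] [[k e] w] /=; first by rewrite family_signed_cons.
by rewrite num_positive_cons exprD.
Qed.

Lemma positive_enum0 F : positive_enum 0 F = 1.
Proof.
rewrite /positive_enum (eq_bigl xpredT); last first.
  by move=> w; case: F => //=; apply/forallP => -[].
rewrite (eq_bigr (fun=> 1)) => [|w _].
  by rewrite sumr_const card_prod card_ffun card_Sn card_ord expn0.
by rewrite num_positiveE /one_line enum_ord0 expr0.
Qed.

(** Iterating [positive_enumS] yields the roots of the arrangement side with opposite signs; type D
    gives up one factor and continues as type C. *)
Lemma positive_enum_prod n F : (0 < n)%N ->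
  positive_enum n F = \prod_(a <- char_roots F n) ('X + a%:R%:P).
Proof.
have C k : positive_enum k TypeC = \prod_(a <- char_roots TypeC k) ('X + a%:R%:P).
  elim: k => [|k IH]; first by rewrite positive_enum0 big_nil.
  by rewrite positive_enumS IH /char_roots -[k.+1]addn1 iotaD map_cat big_cat /=
    big_seq1 mulrC.
case: F => n0; first exact: C.
- elim: n {n0} => [|k IH]; first by rewrite positive_enum0 big_nil.
  by rewrite positive_enumS big_cons IH.
- by case: n n0 => // n _; rewrite positive_enumS big_cons C.
- elim: n {n0} => [|k IH]; first by rewrite positive_enum0 big_nil.
  by rewrite positive_enumS IH /char_roots -[k.+1]addn1 iotaD big_cat /= big_seq1 mulrC.
Qed.

Lemma coef_positive_enum n F j : (positive_enum n F)`_j =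
  #|[set w : signed_perm n | family_signed F w && (num_positive w == j)]|%:R.
Proof.
rewrite coef_sum -sum1_card natr_sum big_mkcond [RHS]big_mkcond /=.
by apply: eq_bigr => w _; rewrite inE coefXn eq_sym; case: family_signed; case: eqP.
Qed.

Theorem theorem6p4 (R : realType) (n : nat) (hn : (1 <= n)%N)
    (F : arr_family) (j : nat) :
  absz ((charpoly (family_arr R n F))`_j)%R =
    #|[set w : signed_perm n | family_signed F w && (num_positive w == j)]|.
Proof.
(* Up to a power of -1, both sides are the same coefficient of the same product. *)
rewrite charpoly_family_prod // coef_prod_roots -positive_enum_prod //.
by rewrite coef_positive_enum abszM abszX exp1n mul1n natz.
Qed.
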